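(* Fix $\varepsilon,\delta,\theta\in(0,1)$. Let $(X,d_X)$ be a metric space which admits, for every $k\in\mathbb Z$, a $2^k$-bounded $(\varepsilon,\delta)$-padded stochastic decomposition. Then the metric space $(X,d_X^\theta)$ embeds into Hilbert space with bi-Lipschitz distortion at most $\frac{C}{\varepsilon\sqrt{\delta\theta(1-\theta)}}$, where $C$ is a universal constant.
   Context: For a partition $\mathscr P$ of $X$ and $x\in X$, $\mathscr P(x)$ is the part containing $x$. For $\Delta>0$, a $\Delta$-bounded stochastic decomposition is a probability distribution $\Pr$ over partitions of $X$ such that almost surely every part has diameter at most $\Delta$. It is $(\varepsilon,\delta)$-padded if for every $x\in X$, $\Pr[\mathscr P(x)\supseteq B_X(x,\varepsilon\Delta)]\ge\delta$, where $B_X(x,r)$ is the closed ball. An embedding $F$ of a metric space $(Z,d_Z)$ into Hilbert space has distortion at most $D$ if there is $s>0$ with $s\,d_Z(a,b)\le\|F(a)-F(b)\|\le sD\,d_Z(a,b)$ for all $a,b$. *)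

(* Defs.v *)
From HB Require Import structures.
From mathcomp Require Import all_boot all_order all_algebra.
From mathcomp Require Import all_classical all_reals all_analysis.
From mathcomp Require Import Rstruct Rstruct_topology.
From Stdlib Require Import Rdefinitions.

Set Implicit Arguments.
Unset Strict Implicit.
Unset Printing Implicit Defensive.

Import Order.TTheory GRing.Theory Num.Theory.
Import numFieldNormedType.Exports.

Local Open Scope classical_set_scope.
Local Open Scope ring_scope.

Definition is_metric (X : Type) (d : X -> X -> R) : Prop :=
  [/\ (forall x y, 0 <= d x y),
      (forall x y, d x y = 0 <-> x = y),
      (forall x y, d x y = d y x) &
      (forall x y z, d x z <= d x y + d y z)].

Definition cball (X : Type) (d : X -> X -> R) (x : X) (r : R) : set X :=
  [set y | d x y <= r].

Definition diam_le (X : Type) (d : X -> X -> R) (A : set X) (D : R) : Prop :=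
  forall a b, A a -> A b -> d a b <= D.

(* A partition of X, given by its part map  x |-> P(x):
   x lies in its own part, and parts are equal or disjoint. *)
Definition is_partition (X : Type) (P : X -> set X) : Prop :=
  (forall x, P x x) /\ (forall x y, P x y -> P y = P x).

(* There is a Delta-bounded (eps,delta)-padded stochastic decomposition of
   (X,d): a probability distribution over partitions of X, represented as a
   random partition  w |-> part w  on some probability space (Omega, Pr),
   such that almost surely every part has diameter at most Delta, and for
   every x the (measurable) event  P(x) ⊇ B_X(x, eps*Delta)  has probability
   at least delta. *)
Definition has_padded_decomposition (X : Type) (d : X -> X -> R)
    (Delta eps delta : R) : Prop :=
  exists (dO : measure_display) (Omega : measurableType dO)
         (Pr : probability Omega R) (part : Omega -> X -> set X),
    [/\ (forall w, is_partition (part w)),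
        {ae Pr, forall w, forall x, diam_le d (part w x) Delta} &
        (forall x,
           let E := [set w | cball d x (eps * Delta) `<=` part w x] in
           measurable E /\ (delta%:E <= Pr E)%E)].

Definition is_inner_product (V : normedModType R) (ip : V -> V -> R) : Prop :=
  [/\ (forall u v, ip u v = ip v u),
      (forall (a : R) (u v w : V), ip (a *: u + v) w = a * ip u w + ip v w) &
      (forall v, ip v v = `|v| ^+ 2)].

Definition embeds_in_hilbert (Z : Type) (dZ : Z -> Z -> R) (D : R) : Prop :=
  exists (V : completeNormedModType R) (ip : V -> V -> R) (F : Z -> V) (s : R),
    [/\ is_inner_product ip, 0 < s &
        forall a b, s * dZ a b <= `|F a - F b| /\ `|F a - F b| <= s * D * dZ a b].

(* Main.v *)
(**
Fix a scale 2^k. If P is a partition with parts of diameter at most 2^k and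
g(x) is the minimum of eps 2^k and the distance from x to the complement of
P(x), then the kernel 1[P(x) = P(y)] g(x) g(y) is positive semidefinite; its
squared distance is at most 2 min(d(x,y), 2^k)^2, and it is at least
(eps 2^k)^2 when d(x,y) > 2^k and x is padded.  Average over P and sum over k
with weights 2^(-2k(1-theta)): geometric series bound the squared distance of
the sum by a multiple of d^(2 theta) / (theta (1-theta)), and the single scale
2^k < d <= 2^(k+1) bounds it below by a multiple of delta eps^2 d^(2 theta).

Since g need not be measurable, the averages are taken over finitely
supported probabilities that agree with the given ones on finitely many
padding events.  This gives, for every finite set of pairs, a kernel with the
upper bound everywhere and the lower bound on these pairs; a limit along an
ultrafilter has both bounds everywhere.  The Hilbert space is the space of
functions on X dual to the kernel (its reproducing kernel space), and the
inner product comes from the parallelogram law.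
*)

Require Import Defs.
From Stdlib Require Import Rdefinitions.
From HB Require Import structures.
From mathcomp Require Import all_boot all_order all_algebra.
From mathcomp Require Import all_classical all_reals all_analysis.
From mathcomp Require Import Rstruct Rstruct_topology.
From mathcomp Require Import zify ring lra.

Set Implicit Arguments.
Unset Strict Implicit.
Unset Printing Implicit Defensive.

Import Order.TTheory GRing.Theory Num.Theory.
Import numFieldNormedType.Exports.

Local Open Scope classical_set_scope.
Local Open Scope ring_scope.

(** * Positive semidefinite kernels and their Hilbert spaces *)

Section FormalCombinations.
Variables (R : realType) (X : Type).
Implicit Types (u v : seq (R * X)) (f g : X -> R) (K : X -> X -> R).

(** The list [u] is read as a finitely supported signed measure, repeated points being allowed, and
    [f] is integrated against it. *)
Definition combine u f : R := \sum_(p <- u) p.1 * f p.2.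

Definition scale_comb (c : R) u := [seq (c * p.1, p.2) | p <- u].

Definition gram K u v : R := combine u (fun x => combine v (K x)).

Definition psd K := (forall x y, K x y = K y x) /\ forall u, 0 <= gram K u u.

Lemma combine_cat u v f : combine (u ++ v) f = combine u f + combine v f.
Proof. by rewrite /combine big_cat. Qed.

Lemma combine_scale c u f : combine (scale_comb c u) f = c * combine u f.
Proof.
by rewrite /combine big_map mulr_sumr; apply: eq_bigr => p _; rewrite mulrA.
Qed.

Lemma combine1 c x f : combine [:: (c, x)] f = c * f x.
Proof. by rewrite /combine big_seq1. Qed.

Lemma combineD u f g : combine u (f + g) = combine u f + combine u g.
Proof.
by rewrite /combine -big_split; apply: eq_bigr => p _; exact: mulrDr.
Qed.

Lemma combineZ c u f : combine u (c *: f) = c * combine u f.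
Proof.
by rewrite /combine mulr_sumr; apply: eq_bigr => p _; rewrite mulrCA.
Qed.

Lemma combineB u f g : combine u (f - g) = combine u f - combine u g.
Proof. by rewrite combineD -scaleN1r combineZ mulN1r. Qed.

Lemma combine0 u : combine u 0 = 0.
Proof. by rewrite /combine big1// => p _; rewrite mulr0. Qed.

Lemma eq_combine u f g : f =1 g -> combine u f = combine u g.
Proof. by move=> /funext->. Qed.

Lemma gramDl K u v w : gram K (u ++ v) w = gram K u w + gram K v w.
Proof. exact: combine_cat. Qed.

Lemma gramZl K c u v : gram K (scale_comb c u) v = c * gram K u v.
Proof. exact: combine_scale. Qed.

Lemma gramC K u v : (forall x y, K x y = K y x) -> gram K u v = gram K v u.
Proof.
move=> Ksym; rewrite /gram /combine.
under eq_bigr do rewrite mulr_sumr.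
rewrite exchange_big; apply: eq_bigr => p _.
rewrite mulr_sumr; apply: eq_bigr => q _.
by rewrite mulrCA (Ksym q.2).
Qed.

Section Psd.
Variables (K : X -> X -> R) (Kpsd : psd K).

Let Ksym : forall x y, K x y = K y x := Kpsd.1.

Lemma gramDr u v w : gram K u (v ++ w) = gram K u v + gram K u w.
Proof. by rewrite gramC// gramDl !(gramC _ u). Qed.

Lemma gramZr c u v : gram K u (scale_comb c v) = c * gram K u v.
Proof. by rewrite gramC// gramZl (gramC _ u). Qed.

Lemma gramDZ t u v : gram K (u ++ scale_comb t v) (u ++ scale_comb t v) =
  gram K u u + 2 * t * gram K u v + t ^+ 2 * gram K v v.
Proof.
rewrite !gramDl !gramDr !gramZl !gramZr (gramC v u)//; ring.
Qed.

End Psd.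

End FormalCombinations.

(** Take the minimiser [t = - b / a]; if [a = 0], a nonconstant affine function of [t] would take
    negative values. *)
Lemma discriminant_le (R : realFieldType) (a b c : R) : 0 <= a -> 0 <= c ->
  (forall t, 0 <= c + 2 * t * b + t ^+ 2 * a) -> b ^+ 2 <= a * c.
Proof.
move=> a0 c0 H; have [a_gt0|a_le0] := ltP 0 a.
  have := H (- b / a); have -> : c + 2 * (- b / a) * b + (- b / a) ^+ 2 * a
      = (a * c - b ^+ 2) / a by field; rewrite gt_eqF.
  by rewrite pmulr_lge0 ?invr_gt0// subr_ge0.
have a_eq0 : a = 0 by apply/eqP; rewrite eq_le a_le0.
have [->|b0] := eqVneq b 0; first by rewrite a_eq0 mul0r expr0n.
(* This [t] solves [c + 2 * t * b = - 1]. *)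
have := H (- (c + 1) / (2 * b)).
have -> : c + 2 * (- (c + 1) / (2 * b)) * b + (- (c + 1) / (2 * b)) ^+ 2 * a
   = - 1 by rewrite a_eq0; field.
by rewrite ler0N1.
Qed.

Lemma gram_CauchySchwarz (R : realType) (X : Type) (K : X -> X -> R)
    (u v : seq (R * X)) :
  psd K -> gram K u v ^+ 2 <= gram K u u * gram K v v.
Proof.
move=> Kpsd; rewrite mulrC; apply: discriminant_le; [exact: Kpsd.2..|].
by move=> t; rewrite -gramDZ//; exact: Kpsd.2.
Qed.

Lemma cvg_combine (R : realType) (X I : Type) (F : set_system I) (u : seq (R * X))
    (f : I -> X -> R) (g : X -> R) : Filter F ->
  (forall x, f i x @[i --> F] --> g x) ->
  combine u (f i) @[i --> F] --> combine u g.
Proof.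
move=> FF fg; apply: cvg_big; first exact: add_continuous.
by move=> p _; apply: cvgMr; exact: fg.
Qed.

Lemma cvg_le_near (R : realType) (I : Type) (F : set_system I) (f : I -> R)
    (l c : R) : ProperFilter F ->
  f i @[i --> F] --> l -> (\forall i \near F, f i <= c) -> l <= c.
Proof.
move=> FF fl fc; rewrite -(cvg_lim (@Rhausdorff R) fl).
by apply: limr_le => //; apply/cvg_ex; exists l.
Qed.

Lemma cvg_ge_near (R : realType) (I : Type) (F : set_system I) (f : I -> R)
    (l c : R) : ProperFilter F ->
  f i @[i --> F] --> l -> (\forall i \near F, c <= f i) -> c <= l.
Proof.
move=> FF fl fc; rewrite -(cvg_lim (@Rhausdorff R) fl).
by apply: limr_ge => //; apply/cvg_ex; exists l.
Qed.

(** * The Hilbert space of a kernel as a space of bounded functionals *)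

Section ReproducingKernelSpace.
Variables (R : realType) (X : Type) (K : X -> X -> R).
Implicit Types (u v : seq (R * X)) (f g : X -> R).

Let len u : R := Num.sqrt (gram K u u).

(** [M] bounds the functional that [f] induces on formal combinations with seminorm [len]. The
    functions with such a bound form a complete space directly, without a completion. *)
Definition dual_bound f (M : R) := 0 <= M /\ forall u, `|combine u f| <= M * len u.

Definition kernel_bounded : {pred (X -> R)} :=
  mem [set f | exists M, dual_bound f M].

Lemma kernel_boundedP f : f \in kernel_bounded <-> exists M, dual_bound f M.
Proof. by split => [/set_mem//|?]; exact/mem_set. Qed.

Lemma dual_boundD f g M N :
  dual_bound f M -> dual_bound g N -> dual_bound (f + g) (M + N).
Proof.
move=> [M0 fM] [N0 gN]; split=> [|u]; first exact: addr_ge0.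
by rewrite combineD mulrDl (le_trans (ler_normD _ _))// lerD.
Qed.

Lemma dual_boundZ c f M : dual_bound f M -> dual_bound (c *: f) (`|c| * M).
Proof.
move=> [M0 fM]; split=> [|u]; first exact: mulr_ge0.
by rewrite combineZ normrM -mulrA ler_wpM2l.
Qed.

Lemma kernel_bounded_submod_closed : submod_closed kernel_bounded.
Proof.
split.
  apply/kernel_boundedP; exists 0; split=> // u.
  by rewrite combine0 normr0 mul0r.
move=> c f g /kernel_boundedP[M fM] /kernel_boundedP[N gN].
apply/kernel_boundedP; exists (`|c| * M + N).
by apply: dual_boundD => //; exact: dual_boundZ.
Qed.

HB.instance Definition _ := GRing.isSubmodClosed.Build _ _ kernel_bounded
  kernel_bounded_submod_closed.

Record rkhs := Rkhs { rkhs_fun :> X -> R ; _ : rkhs_fun \in kernel_bounded }.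

HB.instance Definition _ := [isSub for rkhs_fun].
HB.instance Definition _ := [Choice of rkhs by <:].
HB.instance Definition _ := [SubChoice_isSubLmodule of rkhs by <:].

Definition dual_norm (f : X -> R) : R := inf [set M | dual_bound f M].

Lemma dual_norm_le f M : dual_bound f M -> dual_norm f <= M.
Proof. by move=> fM; apply: ge_inf => //; exists 0 => N []. Qed.

(** The infimum is itself a bound: divide by [len u], or, where [len u = 0], use that any bound
    already forces [combine u f = 0]. *)
Lemma dual_norm_bound (f : rkhs) : dual_bound f (dual_norm f).
Proof.
have /kernel_boundedP[M fM] := valP f.
split=> [|u]; first by apply: lb_le_inf; [exists M|move=> N []].
have [len_gt0|] := ltP 0 (len u); last first.
  move=> len_le0; have len0 : len u = 0.
    by apply/eqP; rewrite eq_le len_le0 sqrtr_ge0.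
  by rewrite len0 mulr0; have := fM.2 u; rewrite len0 mulr0.
rewrite -ler_pdivrMr//; apply: lb_le_inf; first by exists M.
by move=> N [_ fN]; rewrite ler_pdivrMr.
Qed.

Lemma dual_normD (f g : rkhs) :
  dual_norm (f + g : rkhs) <= dual_norm f + dual_norm g.
Proof.
by apply: dual_norm_le; apply: dual_boundD; exact: dual_norm_bound.
Qed.

Lemma dual_normZ_le c (f : rkhs) :
  dual_norm (c *: f : rkhs) <= `|c| * dual_norm f.
Proof. by apply: dual_norm_le; apply: dual_boundZ; exact: dual_norm_bound. Qed.

Lemma dual_normZ c (f : rkhs) : dual_norm (c *: f : rkhs) = `|c| * dual_norm f.
Proof.
apply/eqP; rewrite eq_le dual_normZ_le/=.
have [->|c0] := eqVneq c 0.
  by rewrite normr0 mul0r; exact: (dual_norm_bound (0 *: f)).1.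
rewrite -ler_pdivlMl ?normr_gt0// -normfV.
by apply: le_trans (dual_normZ_le c^-1 (c *: f)); rewrite scalerA mulVf ?scale1r.
Qed.

Lemma dual_norm0_eq0 (f : rkhs) : dual_norm f = 0 -> f = 0.
Proof.
move=> f0; apply/val_inj/funext => x.
have := (dual_norm_bound f).2 [:: (1, x)].
by rewrite f0 mul0r normr_le0 combine1 mul1r => /eqP.
Qed.

HB.instance Definition _ :=
  Lmodule_isNormed.Build R rkhs dual_normD dual_normZ dual_norm0_eq0.

Lemma combine_le_norm (f : rkhs) u : `|combine u f| <= `|f| * len u.
Proof. exact: (dual_norm_bound f).2. Qed.

(** A Cauchy filter converges pointwise because evaluations are bounded; bounds on [combine u]
    survive pointwise limits, so the convergence is also in norm. *)
Lemma rkhs_complete (F : set_system rkhs) : ProperFilter F -> cauchy F -> cvg F.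
Proof.
move=> FF /cauchyP Fcauchy.
have ev_cvg x : cvg ((fun f : rkhs => f x) @ F).
  apply: cauchy_cvg; apply/cauchy_exP => e e0.
  pose l := len [:: (1, x)].
  have l0 : 0 <= l := sqrtr_ge0 _.
  (* The radius is [e / (l + 1)] because [l] may be zero. *)
  have [f0 Ff0] := Fcauchy _ (divr_gt0 e0 (ltr_wpDl l0 ltr01)).
  exists (f0 x); change (F [set f : rkhs | ball (f0 x) e (f x)]).
  apply: filterS Ff0 => f; rewrite -!ball_normE/= => f0f.
  have := combine_le_norm (f0 - f) [:: (1, x)].
  rewrite combine1 mul1r => /le_lt_trans; apply.
  apply: (@le_lt_trans _ _ (e / (l + 1) * l)).
    by rewrite ler_wpM2r// ltW.
  by rewrite -mulrA gtr_pMr// mulrC ltr_pdivrMr ?mul1r ?ltrDl// ltr_wpDl.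
pose h x := lim ((fun f : rkhs => f x) @ F).
have comb_cvg u : (fun f : rkhs => combine u f) @ F --> combine u h.
  by apply: cvg_combine => x; exact: ev_cvg.
have h_bound e : 0 < e -> exists f0 : rkhs, F (ball f0 e) /\ dual_bound (h - f0) e.
  move=> e0; have [f0 Ff0] := Fcauchy _ e0; exists f0; split=> //.
  split=> [|u]; first exact: ltW.
  have : (fun f : rkhs => `|combine u f - combine u f0|) @ F
     --> `|combine u h - combine u f0|.
    by apply: cvg_norm; apply: cvgB => //; exact: cvg_cst.
  move=> /cvg_le_near; rewrite combineB; apply.
  apply: filterS Ff0 => f; rewrite -ball_normE/= => f0f.
  rewrite distrC -combineB; apply: le_trans (combine_le_norm (f0 - f) u) _.
  by rewrite ler_wpM2r ?sqrtr_ge0// ltW.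
have hV : h \in kernel_bounded.
  have [f0 [_ hf0]] := h_bound 1 ltr01; rewrite -(subrK (f0 : X -> R) h).
  by rewrite rpredD ?(valP f0)//; apply/kernel_boundedP; exists 1.
apply/cvg_ex; exists (Rkhs hV); apply/cvgrPdist_le => e e0.
have [f0 [Ff0 hf0]] := h_bound _ (divr_gt0 e0 (ltr0Sn _ 1)).
apply: filterS Ff0 => f; rewrite -ball_normE/= => f0f.
rewrite (splitr e) -(subrKA f0) (le_trans (ler_normD _ _))// lerD//; last exact: ltW.
exact: (@dual_norm_le (Rkhs hV - f0 : rkhs)).
Qed.

HB.instance Definition _ := Uniform_isComplete.Build rkhs rkhs_complete.

End ReproducingKernelSpace.


(** * Parallelogram law and point vectors *)

Section RkhsInnerProduct.
Variables (R : realType) (X : Type) (K : X -> X -> R) (Kpsd : psd K).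

(** Half of the variational formula for [|f|^2] as the supremum of [2 * combine u f - gram K u u];
    scaling [u] turns the hypothesis into a discriminant condition. *)
Lemma rkhs_norm_sqr_le (f : rkhs K) c :
  (forall u, 2 * combine u f - gram K u u <= c) -> `|f| ^+ 2 <= c.
Proof.
move=> fc; have c0 : 0 <= c.
  by have := fc [::]; rewrite /gram /combine !big_nil mulr0 subrr.
have sqr_le u : combine u f ^+ 2 <= gram K u u * c.
  rewrite -sqrrN; apply: discriminant_le => //; first exact: Kpsd.2.
  move=> t; have := fc (scale_comb t u).
  rewrite combine_scale gramZl gramZr// -subr_ge0 => /le_trans; apply.
  by rewrite le_eqVlt; apply/orP; left; apply/eqP; ring.
have: `|f| <= Num.sqrt c.
  apply: dual_norm_le; split=> [|u]; first exact: sqrtr_ge0.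
  by rewrite -sqrtrM// -sqrtr_sqr ler_wsqrtr// mulrC.
by rewrite -(ler_pXn2r (ltn0Sn 1)) ?nnegrE ?sqrtr_ge0 ?sqr_sqrtr.
Qed.

(** The square of [2 * |f| - l] is nonnegative, where [l] is the length of [u]. The halved Gram term
    fits the identity by which the forms at [u + v] and [u - v] add up to twice those at [u] and
    [v]. *)
Lemma combine_energy_le (f : rkhs K) u :
  2 * combine u f - gram K u u / 2 <= 2 * `|f| ^+ 2.
Proof.
have := le_trans (ler_norm _) (combine_le_norm f u).
have : gram K u u = Num.sqrt (gram K u u) ^+ 2 by rewrite sqr_sqrtr ?Kpsd.2.
move: (Num.sqrt _) => l ->; have := sqr_ge0 (2 * `|f| - l); nra.
Qed.

(** Test [f + g] with [u] and [f - g] with [v]: the total pairs [f] with [u + v] and [g] with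
    [u - v], and the energy estimate applies to each. *)
Lemma rkhs_parallelogram_le (f g : rkhs K) :
  `|f + g| ^+ 2 + `|f - g| ^+ 2 <= 2 * `|f| ^+ 2 + 2 * `|g| ^+ 2.
Proof.
rewrite -lerBrDr; apply: rkhs_norm_sqr_le => u.
rewrite lerBrDr addrC -lerBrDr; apply: rkhs_norm_sqr_le => v.
rewrite lerBrDr -subr_ge0.
have := combine_energy_le f (u ++ v).
have := combine_energy_le g (u ++ scale_comb (- 1) v).
have -> : combine u (f + g : rkhs K) = combine u f + combine u g.
  exact: combineD.
have -> : combine v (f - g : rkhs K) = combine v f - combine v g.
  exact: combineB.
rewrite gramDZ// !combine_cat combine_scale !gramDl !gramDr// (gramC v u Kpsd.1).
lra.
Qed.

(** The reverse inequality is the first one applied to [f + g] and [f - g]. *)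
Lemma rkhs_parallelogram (f g : rkhs K) :
  `|f + g| ^+ 2 + `|f - g| ^+ 2 = 2 * `|f| ^+ 2 + 2 * `|g| ^+ 2.
Proof.
apply/eqP; rewrite eq_le rkhs_parallelogram_le/=.
have := rkhs_parallelogram_le (f + g) (f - g).
have -> : f + g + (f - g) = 2 *: f by rewrite scaler_nat mulr2n addrACA subrr addr0.
have -> : f + g - (f - g) = 2 *: g.
  by rewrite scaler_nat mulr2n opprB [g - f]addrC addrACA subrr add0r.
rewrite !normrZ normr_nat; lra.
Qed.

Definition rkhs_point (x : X) : rkhs K.
Proof.
exists (K x); apply/kernel_boundedP; exists (Num.sqrt (K x x)).
split=> [|u]; first exact: sqrtr_ge0.
have -> : combine u (K x) = gram K [:: (1, x)] u by rewrite /gram combine1 mul1r.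
have -> : K x x = gram K [:: (1, x)] [:: (1, x)] by rewrite /gram !combine1 !mul1r.
rewrite -sqrtrM ?Kpsd.2// -sqrtr_sqr ler_wsqrtr//.
exact: gram_CauchySchwarz.
Defined.

Definition kernel_sqdist (x y : X) : R := K x x - 2 * K x y + K y y.

(** The difference represents [w], the point mass at [x] minus that at [y]. The upper bound
    expresses that the Gram form at [w - u] is nonnegative. *)
Lemma rkhs_point_dist x y :
  `|rkhs_point x - rkhs_point y| ^+ 2 = kernel_sqdist x y.
Proof.
pose w : seq (R * X) := [:: (1, x); (-1, y)].
have wE u : combine u (rkhs_point x - rkhs_point y : rkhs K) = gram K w u.
  rewrite (_ : _ (_ - _) = K x - K y)// combineB /gram /combine !big_cons big_nil /=.
  by rewrite mul1r mulN1r addr0.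
have wwE : gram K w w = kernel_sqdist x y.
  rewrite /gram /combine !big_cons !big_nil/= /kernel_sqdist (Kpsd.1 y x); ring.
apply/eqP; rewrite eq_le; apply/andP; split.
  apply: rkhs_norm_sqr_le => u; rewrite wE -wwE -subr_ge0.
  have := Kpsd.2 (w ++ scale_comb (- 1) u); rewrite gramDZ//; lra.
(* The test combination [2 w] makes the energy estimate sharp. *)
have := combine_energy_le (rkhs_point x - rkhs_point y) (scale_comb 2 w).
rewrite wE !gramZl !gramZr// wwE; lra.
Qed.

End RkhsInnerProduct.

(** * The inner product from the parallelogram law *)

Section JordanVonNeumann.
Variables (R : realType) (V : normedModType R).
Hypothesis parallelogram : forall u v : V,
  `|u + v| ^+ 2 + `|u - v| ^+ 2 = 2 * `|u| ^+ 2 + 2 * `|v| ^+ 2.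

Definition polar (u v : V) : R := (`|u + v| ^+ 2 - `|u - v| ^+ 2) / 4.

Lemma polarC u v : polar u v = polar v u.
Proof. by rewrite /polar (addrC u) (distrC u). Qed.

Lemma polar_diag v : polar v v = `|v| ^+ 2.
Proof.
rewrite /polar subrr normr0 -mulr2n -scaler_nat normrZ normr_nat; lra.
Qed.

(** In a signed sum of four parallelogram identities the mixed norms [|u + w - v|] and [|v + w - u|]
    cancel. *)
Lemma polarD u v w : polar (u + v) w = polar u w + polar v w.
Proof.
have := parallelogram (u + w) v; have := parallelogram (v + w) u.
have := parallelogram (u - w) v; have := parallelogram (v - w) u.
rewrite (_ : v - w + u = u + v - w); last by rewrite addrC addrA.
rewrite (_ : u - w + v = u + v - w); last by rewrite addrAC.
rewrite (_ : v + w + u = u + v + w); last by rewrite addrC addrA.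
rewrite (_ : u + w + v = u + v + w); last by rewrite addrAC.
rewrite (_ : `|v - w - u| = `|u + w - v|); last first.
  by rewrite distrC opprB addrA.
rewrite (_ : `|u - w - v| = `|v + w - u|); last first.
  by rewrite distrC opprB addrA.
rewrite /polar; lra.
Qed.

Lemma polar0 w : polar 0 w = 0.
Proof. by have := polarD 0 0 w; rewrite addr0; lra. Qed.

Lemma polarMn u w n : polar (u *+ n) w = n%:R * polar u w.
Proof.
elim: n => [|n IH]; first by rewrite mulr0n polar0 mul0r.
by rewrite mulrS polarD IH -natr1; ring.
Qed.

Lemma polar_le u w : `|polar u w| <= `|u| ^+ 2 + `|w| ^+ 2.
Proof.
have := parallelogram u w; rewrite /polar ler_norml.
have := sqr_ge0 `|u + w|; have := sqr_ge0 `|u - w|.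
have := sqr_ge0 `|u|; have := sqr_ge0 `|w|.
by move=> *; apply/andP; split; lra.
Qed.

(* The defect [t |-> polar (t *: u) w - t * polar u w] is additive, vanishes on
   the integers and is bounded on [0, 1]; hence it vanishes. *)
Lemma polarZ t u w : polar (t *: u) w = t * polar u w.
Proof.
pose e s := polar (s *: u) w - s * polar u w.
have eD s r : e (s + r) = e s + e r by rewrite /e scalerDl polarD; ring.
have eMn s n : e (s *+ n) = n%:R * e s.
  by rewrite /e -mulr_natl -scalerA scaler_nat polarMn; ring.
have eint (z : int) : e z%:~R = 0.
  have e1 n : e n%:R = 0 by rewrite eMn /e scale1r; ring.
  case: z => n; rewrite ?NegzE ?mulrNz; first exact: e1.
  by have := eD n.+1%:R (- n.+1%:R); rewrite subrr (e1 0%N) e1 add0r => <-.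
pose B := `|u| ^+ 2 + `|w| ^+ 2 + `|polar u w|.
have eB s : 0 <= s < 1 -> `|e s| <= B.
  move=> /andP[s0 s1]; apply: (le_trans (ler_normB _ _)); apply: lerD.
    apply: (le_trans (polar_le _ _)); rewrite lerD2r normrZ ger0_norm// exprMn.
    by rewrite ler_piMl ?sqr_ge0// expr_le1// ltW.
  by rewrite normrM ger0_norm// ler_piMl// ltW.
(* Additivity reduces [n * e t] to the value of [e] at the fractional part of [n t], so one bound
   serves all [n]. *)
have enB n : n%:R * `|e t| <= B.
  rewrite -[n%:R]ger0_norm// -normrM -eMn.
  have -> : e (t *+ n) = e (t *+ n - (Num.floor (t *+ n))%:~R).
    by rewrite eD -mulrNz eint addr0.
  apply: eB; rewrite subr_ge0 ge_floor/= ltrBlDl -intrD1 lt_succ_floor.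
by [].
suff : `|e t| <= 0 by rewrite normr_le0 subr_eq0 => /eqP.
rewrite leNgt; apply/negP => et0.
have B0 : 0 <= B by rewrite !addr_ge0.
have := enB (Num.bound (B / `|e t|)); rewrite leNgt => /negP; apply.
by rewrite -ltr_pdivrMr// archi_boundP// divr_ge0.
Qed.

End JordanVonNeumann.

Lemma parallelogram_inner_product (V : normedModType R) :
  (forall u v : V, `|u + v| ^+ 2 + `|u - v| ^+ 2 = 2 * `|u| ^+ 2 + 2 * `|v| ^+ 2) ->
  is_inner_product (@polar R V).
Proof.
move=> par; split=> [u v|a u v w|v]; [exact: polarC| |exact: polar_diag].
by rewrite polarD// polarZ.
Qed.

Lemma psd_embeds (X : Type) (K : X -> X -> R) (dX : X -> X -> R) (L U D : R) :
  psd K -> 0 < L -> 0 <= D -> U <= L * D ^+ 2 -> (forall x y, 0 <= dX x y) ->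
  (forall x y, L * dX x y ^+ 2 <= kernel_sqdist K x y <= U * dX x y ^+ 2) ->
  embeds_in_hilbert dX D.
Proof.
move=> Kpsd L0 D0 ULD dX0 Kd.
have s0 : 0 < Num.sqrt L by rewrite sqrtr_gt0.
exists (rkhs K), (@polar R (rkhs K)), (rkhs_point Kpsd), (Num.sqrt L); split=> //.
  exact/parallelogram_inner_product/rkhs_parallelogram.
move=> x y; have /andP[lo up] := Kd x y.
have LE : L = Num.sqrt L ^+ 2 by rewrite sqr_sqrtr// ltW.
split; rewrite -(ler_pXn2r (ltn0Sn 1)) ?nnegrE ?mulr_ge0// ?(ltW s0)//.
  by rewrite exprMn -LE rkhs_point_dist.
rewrite rkhs_point_dist !exprMn -LE; apply: le_trans up _.
by rewrite ler_wpM2r ?sqr_ge0.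
Qed.

(** * Kernels of partitions and of padded decompositions *)

Lemma combine_sum (R : realType) (X I : Type) (s : seq I) (u : seq (R * X))
    (f : I -> X -> R) :
  combine u (fun x => \sum_(i <- s) f i x) = \sum_(i <- s) combine u (f i).
Proof.
rewrite /combine exchange_big; apply: eq_bigr => p _; exact: mulr_sumr.
Qed.

Lemma gram_sum (R : realType) (X I : Type) (s : seq I) (u v : seq (R * X))
    (w : I -> R) (K : I -> X -> X -> R) :
  gram (fun x y => \sum_(i <- s) w i * K i x y) u v =
  \sum_(i <- s) w i * gram (K i) u v.
Proof.
transitivity (combine u (fun x => \sum_(i <- s) w i * combine v (K i x))).
  apply: eq_combine => x; rewrite combine_sum; apply: eq_bigr => i _.
  exact: combineZ.
by rewrite combine_sum; apply: eq_bigr => i _; exact: combineZ.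
Qed.

Lemma psd_sum (R : realType) (X I : Type) (s : seq I) (w : I -> R)
    (K : I -> X -> X -> R) :
  (forall i, 0 <= w i) -> (forall i, psd (K i)) ->
  psd (fun x y => \sum_(i <- s) w i * K i x y).
Proof.
move=> w0 Kpsd; split=> [x y|u].
  by apply: eq_bigr => i _; rewrite (Kpsd i).1.
by rewrite gram_sum sumr_ge0// => i _; rewrite mulr_ge0// (Kpsd i).2.
Qed.

Lemma kernel_sqdist_sum (R : realType) (X I : Type) (s : seq I) (w : I -> R)
    (K : I -> X -> X -> R) x y :
  kernel_sqdist (fun x y => \sum_(i <- s) w i * K i x y) x y =
  \sum_(i <- s) w i * kernel_sqdist (K i) x y.
Proof.
rewrite /kernel_sqdist mulr_sumr -sumrB -big_split; apply: eq_bigr => i _ /=.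
ring.
Qed.

Definition class_kernel (R : realType) (X : Type) (T : eqType) (lab : X -> T)
    (h : X -> R) x y : R := (lab x == lab y)%:R * (h x * h y).

(** The Gram form is a sum of squares, one for each label occurring in [u]. *)
Lemma psd_class_kernel (R : realType) (X T : eqType) (lab : X -> T) (h : X -> R) :
  psd (class_kernel lab h).
Proof.
split=> [x y|u]; first by rewrite /class_kernel eq_sym (mulrC (h x)).
pose s := undup [seq lab p.2 | p <- u].
suff -> : gram (class_kernel lab h) u u =
    \sum_(A <- s) combine u (fun x => (lab x == A)%:R * h x) ^+ 2.
  by rewrite sumr_ge0// => A _; exact: sqr_ge0.
rewrite /gram /combine.
under [RHS]eq_bigr do rewrite expr2 mulr_suml.
rewrite exchange_big; apply: eq_big_seq => p pu.
rewrite mulr_sumr; under [RHS]eq_bigr do rewrite mulr_sumr.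
rewrite exchange_big; apply: eq_bigr => q _ /=.
rewrite (bigD1_seq (lab p.2)) ?undup_uniq ?mem_undup//=; last exact: map_f.
rewrite big1 => [|A /negbTE]; last by rewrite eq_sym => ->; rewrite mul0r mulr0 mul0r.
rewrite eqxx /class_kernel (eq_sym (lab q.2)) mul1r addr0; ring.
Qed.

(** * The kernel of a single partition *)

Section PartitionKernel.
Variables (X : choiceType) (d : X -> X -> R) (P : X -> set X) (c : R).
Hypotheses (dmet : is_metric d) (Ppart : is_partition P) (c0 : 0 <= c).

Let d_ge0 : forall x y, 0 <= d x y := let: And4 h _ _ _ := dmet in h.
Let d_sym : forall x y, d x y = d y x := let: And4 _ _ h _ := dmet in h.
Let d_tri : forall x y z, d x z <= d x y + d y z := let: And4 _ _ _ h := dmet in h.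

(** Including [c] truncates the distance to the complement and keeps the set nonempty when the part
    is all of [X]. *)
Let outer_dists x : set R := c |` [set d x z | z in ~` P x].

Definition depth (x : X) : R := inf (outer_dists x).

Let outer_dists_lb x : lbound (outer_dists x) 0.
Proof. by move=> _ [->//|[z _ <-]]. Qed.

Let outer_dists_neq0 x : outer_dists x !=set0.
Proof. by exists c; left. Qed.

Let depth_glb x r : r <= c -> (forall z, ~ P x z -> r <= d x z) -> r <= depth x.
Proof.
move=> rc rP; apply: lb_le_inf => // _ [->//|[z Pxz <-]].
exact: rP.
Qed.

Lemma depth_ge0 x : 0 <= depth x.
Proof. exact: depth_glb. Qed.

Lemma depth_le x : depth x <= c.
Proof. by apply: ge_inf; [exists 0; exact: outer_dists_lb|left]. Qed.

Lemma depth_le_dist x y : ~ P x y -> depth x <= d x y.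
Proof.
by move=> Pxy; apply: ge_inf; [exists 0; exact: outer_dists_lb|right; exists y].
Qed.

(** Points of one part share its complement, so the triangle inequality compares their distances to
    it. *)
Lemma depth_lipschitz x y : P x y -> depth x - depth y <= d x y.
Proof.
move=> Pxy; rewrite lerBlDr -lerBlDl; apply: depth_glb.
  by rewrite lerBlDl (le_trans (depth_le x))// lerDr.
move=> z; rewrite (Ppart.2 _ _ Pxy) => Pxz.
by rewrite lerBlDl (le_trans (depth_le_dist Pxz)).
Qed.

Lemma depth_padded x : cball d x c `<=` P x -> depth x = c.
Proof.
move=> ball_sub; apply/eqP; rewrite eq_le depth_le; apply: depth_glb => // z Pxz.
by rewrite leNgt; apply/negP => /ltW /ball_sub.
Qed.

Definition partition_kernel : X -> X -> R := class_kernel P depth.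

Let P_sym x y : P x y -> P y x.
Proof. by move=> Pxy; rewrite (Ppart.2 _ _ Pxy); exact: Ppart.1. Qed.

Lemma partition_sqdist_same x y : P x y ->
  kernel_sqdist partition_kernel x y = (depth x - depth y) ^+ 2.
Proof.
move=> Pxy; rewrite /kernel_sqdist /partition_kernel /class_kernel.
by rewrite (Ppart.2 _ _ Pxy) !eqxx !mul1r; ring.
Qed.

Lemma partition_sqdist_diff x y : ~ P x y ->
  kernel_sqdist partition_kernel x y = depth x ^+ 2 + depth y ^+ 2.
Proof.
move=> Pxy; rewrite /kernel_sqdist /partition_kernel /class_kernel !eqxx.
have /negbTE -> : P x != P y.
  by apply/eqP => PE; apply: Pxy; rewrite PE; exact: Ppart.1.
rewrite mul0r !mul1r; ring.
Qed.

(** Inside a part [depth] is 1-Lipschitz with values in [[0, c]]; across parts both depths are at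
    most [d x y] and [c], which costs the factor 2. *)
Lemma partition_sqdist_le x y :
  kernel_sqdist partition_kernel x y <= 2 * Num.min (d x y) c ^+ 2.
Proof.
have sqr_le (a : R) : - Num.min (d x y) c <= a <= Num.min (d x y) c ->
    a ^+ 2 <= Num.min (d x y) c ^+ 2.
  by move: (Num.min _ _) => m /andP[]; nra.
have [Pxy|Pxy] := pselect (P x y).
  rewrite partition_sqdist_same//.
  apply: le_trans (_ : Num.min (d x y) c ^+ 2 <= _); last first.
    by have := sqr_ge0 (Num.min (d x y) c); lra.
  apply: sqr_le; rewrite lerNl opprB !le_min depth_lipschitz// d_sym.
  rewrite (depth_lipschitz (P_sym Pxy))/=.
  have := depth_le x; have := depth_le y; have := depth_ge0 x; have := depth_ge0 y.
  by move=> *; apply/andP; split; lra.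
rewrite partition_sqdist_diff// mulr2n mulrDl !mul1r.
have m0 : 0 <= Num.min (d x y) c by rewrite le_min d_ge0.
apply: lerD; apply: sqr_le; (apply/andP; split; first by
  apply: (@le_trans _ _ 0); rewrite ?oppr_le0 ?depth_ge0).
  by rewrite le_min depth_le_dist// depth_le.
rewrite le_min depth_le andbT d_sym depth_le_dist// => Pyx.
by apply: Pxy; exact: P_sym.
Qed.

Lemma partition_sqdist_ge x y : ~ P x y ->
  (`[< cball d x c `<=` P x >])%:R * c ^+ 2 <= kernel_sqdist partition_kernel x y.
Proof.
move=> Pxy; rewrite partition_sqdist_diff//.
have [/asboolP/depth_padded->|_] := boolP `[< _ >].
  by rewrite mul1r lerDl sqr_ge0.
by rewrite mul0r addr_ge0 ?sqr_ge0.
Qed.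

End PartitionKernel.

(* Only the padding events are assumed measurable, so the random partition is
   replaced by one sample point in each atom of the algebra they generate. *)
Lemma discretize_probability (X : eqType) (dO : measure_display)
    (Omega : measurableType dO) (Pr : probability Omega R)
    (A : X -> set Omega) (S : seq X) (G : set Omega) :
  (forall x, measurable (A x)) -> measurable G ->
  exists s : seq (R * Omega),
    [/\ forall p, p \in s -> 0 <= p.1 /\ G p.2,
        \sum_(p <- s) p.1 = fine (Pr G) &
        forall x, x \in S ->
          \sum_(p <- s) p.1 * (`[< A x p.2 >])%:R = fine (Pr (G `&` A x))].
Proof.
move=> mA; pose m B := fine (Pr B).
have m_ge0 B : 0 <= m B by apply: fine_ge0; exact: measure_ge0.
have m_split B C : measurable B -> measurable C -> m B = m (B `&` C) + m (B `\` C).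
  move=> mB mC; rewrite /m -fineD ?fin_num_measure//;
    [|exact: measurableI|exact: measurableD].
  by congr fine; rewrite addeC; exact: measureDI.
(* Each event splits [G] in two; a nonempty leaf gives its whole mass to one sample point. *)
elim: S G => [|x S IH] G mG.
  have [->|/set0P[w Gw]] := eqVneq G set0.
    by exists [::]; split => //; rewrite big_nil measure0.
  exists [:: (m G, w)]; split => //; last by rewrite big_seq1.
  by move=> p; rewrite inE => /eqP->; split; [exact: m_ge0|exact: Gw].
have mGA : measurable (G `&` A x) by exact: measurableI.
have mGD : measurable (G `\` A x) by exact: measurableD.
have [s1 [s1G s1sum s1S]] := IH _ mGA.
have [s2 [s2G s2sum s2S]] := IH _ mGD.
exists (s1 ++ s2); split.
- move=> p; rewrite mem_cat => /orP[/s1G[? []//]|/s2G[? []//]].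
- by rewrite big_cat/= s1sum s2sum; exact/esym/m_split.
- move=> y; rewrite inE big_cat/= => /orP[/eqP ->|yS].
    (* [A x] holds at every point of [s1] and fails at every point of [s2]. *)
    rewrite -s1sum (eq_big_seq (fun p => p.1)) => [|p /s1G[_ [_ Ap]]]; last first.
      by rewrite asboolT// mulr1.
    rewrite [X in _ + X]big1_seq ?addr0// => p /andP[_ /s2G[_ [_ Ap]]].
    by rewrite asboolF// mulr0.
  rewrite s1S// s2S// (setIAC G (A x)) setIDAC setIDA.
  by apply/esym/m_split => //; exact: measurableI.
Qed.

(** Partition kernels with [c = eps * Delta] are averaged over a discretized probability that avoids
    the null set of bad partitions; [S] lists the points whose padding probabilities have to be
    preserved. *)
Lemma scale_kernel (X : choiceType) (d : X -> X -> R) (Delta eps delta : R)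
    (S : seq X) :
  is_metric d -> 0 <= Delta -> 0 < eps < 1 ->
  has_padded_decomposition d Delta eps delta ->
  exists K, [/\ psd K,
    forall x y, kernel_sqdist K x y <= 2 * Num.min (d x y) Delta ^+ 2 &
    forall x y, x \in S -> Delta < d x y ->
      delta * (eps * Delta) ^+ 2 <= kernel_sqdist K x y].
Proof.
move=> dmet Delta0 /andP[eps0 eps1] [dO [T [Pr [parts [part_is diam pad]]]]].
have d_ge0 x y : 0 <= d x y by case: dmet.
pose c := eps * Delta; have c0 : 0 <= c by rewrite mulr_ge0// ltW.
have [N [mN PrN0 diamN]] := diam.
have PrNC : Pr (~` N) = 1%E by rewrite probability_setC ?PrN0 ?sube0.
pose E x := [set w | cball d x c `<=` parts w x].
have [s [sG s_sum sS]] := discretize_probability Pr S (fun x => (pad x).1)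
  (measurableC mN).
(* [psd_sum] asks for nonnegative weights at every index, even outside [s]. *)
exists (fun x y => \sum_(p <- s) Num.max 0 p.1 * partition_kernel d (parts p.2) c x y).
have sqdistE x y : kernel_sqdist (fun x y =>
    \sum_(p <- s) Num.max 0 p.1 * partition_kernel d (parts p.2) c x y) x y =
    \sum_(p <- s) p.1 * kernel_sqdist (partition_kernel d (parts p.2) c) x y.
  rewrite kernel_sqdist_sum; apply: eq_big_seq => p /sG[p0 _].
  by rewrite max_r.
split.
- apply: psd_sum => p; first by rewrite le_max lexx.
  exact: psd_class_kernel.
- move=> x y; rewrite sqdistE.
  apply: (@le_trans _ _ (\sum_(p <- s) p.1 * (2 * Num.min (d x y) Delta ^+ 2)));
    last by rewrite -mulr_suml s_sum PrNC mul1r.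
  rewrite big_seq [leRHS]big_seq; apply: ler_sum => p /sG[p0 _].
  apply: ler_wpM2l => //.
  apply: (le_trans (partition_sqdist_le dmet (part_is _) c0 x y)).
  rewrite ler_wpM2l// ler_pXn2r ?nnegrE ?le_min ?d_ge0//.
  rewrite !ge_min lexx/=.
  by apply/orP; right; rewrite ler_piMl// ltW.
- move=> x y xS xy; rewrite sqdistE.
  (* Discarding the null set [N] leaves the probability of [E x] unchanged. *)
  have deltaE : delta <= \sum_(p <- s) p.1 * (`[< E x p.2 >])%:R.
    rewrite sS//; have [mE] := pad x.
    rewrite -lee_fin fineK ?fin_num_measure//; last first.
      by apply: measurableI => //; exact: measurableC.
    rewrite (measureDI Pr mE mN) (@subset_measure0 _ _ _ Pr (_ `&` N) N)//.
    - by rewrite adde0 setDE setIC.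
    - exact: measurableI.
  apply: (le_trans (ler_wpM2r (sqr_ge0 c) deltaE)).
  rewrite mulr_suml big_seq [leRHS]big_seq; apply: ler_sum => p /sG[p0 Np].
  (* Outside [N] a part has diameter at most [Delta < d x y], so it cannot contain both points. *)
  rewrite -mulrA ler_wpM2l//; apply: partition_sqdist_ge => // Pxy.
  have diam_p : forall z, diam_le d (parts p.2 z) Delta.
    by apply: contrapT => ndiam; apply: Np; exact: diamN.
  by have := diam_p x x y ((part_is _).1 x) Pxy; rewrite leNgt xy.
Qed.

(** * Summation over dyadic scales *)

Lemma half_le_ln2 (R : realType) : 1 / 2 <= ln 2 :> R.
Proof.
rewrite -ler_expR lnK ?posrE//.
have := expR_ge1Dx (- (1 / 2) : R); rewrite expRN => e_inv.
by rewrite -lef_pV2 ?posrE ?expR_gt0//; lra.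
Qed.

(** [2^(2a) >= e^a >= 1 + a], and [(1 + a)(1 - a/2) >= 1] on [[0, 1]]. This controls the
    denominators of the geometric series. *)
Lemma powR2_gap (R : realType) (a : R) : 0 <= a <= 1 ->
  a / 2 <= 1 - (2 `^ (2 * a))^-1.
Proof.
move=> /andP[a0 a1]; rewrite lerBrDl -lerBrDr.
have a1_gt0 : 0 < 1 + a by rewrite ltr_pwDl.
apply: (@le_trans _ _ (1 + a)^-1).
  rewrite lef_pV2 ?posrE ?powR_gt0//; apply: (le_trans (expR_ge1Dx a)).
  by rewrite /powR pnatr_eq0/= ler_expR; have := half_le_ln2 R; nra.
by rewrite -[leLHS]mul1r ler_pdivrMr//; nra.
Qed.

Section DyadicSum.
Variables (R : realType) (theta r : R).
Hypotheses (theta01 : 0 < theta < 1) (r0 : 0 < r).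

Let tau := 1 - theta.

Let theta_gt0 : 0 < theta. Proof. by case/andP: theta01. Qed.

Let tau_gt0 : 0 < tau. Proof. by rewrite subr_gt0; case/andP: theta01. Qed.

Let theta_le1 : 0 <= theta <= 1. Proof. by case/andP: theta01 => /ltW-> /ltW->. Qed.

Let tau_le1 : 0 <= tau <= 1.
Proof. by rewrite (ltW tau_gt0) gerBl ltW. Qed.

(** [low] stops growing at [t = r] and [high] starts to fall there, so along dyadic scales the first
    changes geometrically below [r] and the second above. *)
Let low t := Num.min r t `^ (2 * theta).
Let high t := r ^+ 2 / Num.max r t `^ (2 * tau).

Lemma powR_split (t : R) : 0 < t -> t ^+ 2 / t `^ (2 * tau) = t `^ (2 * theta).
Proof.
move=> t0; rewrite -powR_mulrn ?(ltW t0)// -powRB ?(gt_eqF t0) ?implybT//.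
by congr (_ `^ _); rewrite /tau; ring.
Qed.

Let low_homo (s t : R) : 0 < s -> s <= t -> low s <= low t.
Proof.
move=> s0 st; have t0 : 0 < t := lt_le_trans s0 st.
apply: ge0_ler_powR; rewrite ?nnegrE ?mulr_ge0 ?(ltW theta_gt0)//.
- by rewrite le_min !ltW.
- by rewrite le_min !ltW.
- by rewrite le_min !ge_min lexx st orbT.
Qed.

Let high_homo s t : s <= t -> high t <= high s.
Proof.
move=> st; rewrite ler_wpM2l ?sqr_ge0// lef_pV2 ?posrE ?powR_gt0 ?lt_max ?r0//.
apply: ge0_ler_powR; rewrite ?nnegrE ?mulr_ge0 ?(ltW tau_gt0)//.
- by rewrite le_max (ltW r0).
- by rewrite le_max (ltW r0).
by rewrite ge_max !le_max lexx st orbT.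
Qed.

Let term t := (t `^ (2 * tau))^-1 * Num.min r t ^+ 2.

(* Along t = 2^k the right-hand side telescopes; its first bracket absorbs the
   scales t <= r and its second bracket the scales t > r. *)
Lemma dyadic_term_le (t : R) : 0 < t ->
  term t <= 2 / theta * (low t - low (t / 2)) + 2 / tau * (high t - high (2 * t)).
Proof.
move=> t0; have th0 : 0 < t / 2 by rewrite divr_gt0.
have low_ge : 0 <= low t - low (t / 2) by rewrite subr_ge0 low_homo//; lra.
have high_ge : 0 <= high t - high (2 * t) by rewrite subr_ge0 high_homo//; lra.
have [tr|rt] := leP t r.
  rewrite -[leLHS]addr0; apply: lerD; last by rewrite mulr_ge0// divr_ge0// ltW.
  rewrite /term /low !min_r//; last by apply: le_trans tr; lra.
  rewrite mulrC powR_split//.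
  have -> : (t / 2) `^ (2 * theta) = t `^ (2 * theta) * (2 `^ (2 * theta))^-1.
    rewrite powRM ?invr_ge0 ?(ltW t0)//; congr (_ * _).
    by rewrite -powR_inv1// -powRrM mulN1r powRN.
  (* The gap estimate gives [low t - low (t / 2) >= theta / 2 * low t]. *)
  have := powR2_gap theta_le1; move: ((2 `^ _)^-1) => z gap.
  have p0 : 0 <= t `^ (2 * theta) by exact: powR_ge0.
  move: (t `^ _) p0 => p p0; rewrite -[leLHS]mul1r.
  rewrite (_ : 2 / theta * (p - p * z) = (2 / theta * (1 - z)) * p); last by ring.
  apply: ler_wpM2r => //; rewrite mulrAC ler_pdivlMr//; lra.
rewrite -[leLHS]add0r; apply: lerD; first by rewrite mulr_ge0// divr_ge0// ltW.
rewrite /term /high min_l ?max_r ?(ltW rt)//; last by lra.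
rewrite powRM ?(ltW t0)// invfM.
have := powR2_gap tau_le1; move: ((2 `^ _)^-1) => z gap.
have p0 : 0 <= (t `^ (2 * tau))^-1 * r ^+ 2.
  by rewrite mulr_ge0 ?sqr_ge0 ?invr_ge0 ?powR_ge0.
move: ((t `^ _)^-1) p0 => p p0; rewrite -[leLHS]mul1r.
rewrite (_ : 2 / tau * _ = (2 / tau * (1 - z)) * (p * r ^+ 2)); last by ring.
apply: ler_wpM2r => //; rewrite mulrAC ler_pdivlMr//; lra.
Qed.

Lemma dyadic_sum_le (t : nat -> R) n :
  (forall i, 0 < t i) -> (forall i, t i.+1 = 2 * t i) ->
  \sum_(0 <= i < n) term (t i) <= 2 / (theta * tau) * r `^ (2 * theta).
Proof.
move=> t0 tS; pose lo i := low (t i / 2); pose hi i := - high (t i).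
have lohi i : term (t i) <=
    2 / theta * (lo i.+1 - lo i) + 2 / tau * (hi i.+1 - hi i).
  have := dyadic_term_le (t0 i).
  by rewrite /lo /hi tS (mulrC 2 (t i)) mulfK// opprK [- _ + _]addrC.
apply: (le_trans (ler_sum_nat (fun i _ => lohi i))).
rewrite big_split/= -!mulr_sumr !telescope_sumr//.
have lo_le i : 0 <= lo i <= r `^ (2 * theta).
  rewrite powR_ge0/=; apply: ge0_ler_powR;
    rewrite ?nnegrE ?mulr_ge0 ?(ltW theta_gt0) ?(ltW r0)//.
    by rewrite le_min !ltW// divr_gt0.
  by rewrite ge_min lexx.
have hi_le i : - r `^ (2 * theta) <= hi i <= 0.
  rewrite /hi oppr_le0 lerN2; apply/andP; split; last first.
    by rewrite divr_ge0 ?sqr_ge0 ?powR_ge0.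
  rewrite -powR_split// ler_wpM2l ?sqr_ge0// lef_pV2 ?posrE ?powR_gt0 ?lt_max ?r0//.
  by apply: ge0_ler_powR;
    rewrite ?nnegrE ?mulr_ge0 ?(ltW tau_gt0) ?le_max ?(ltW r0) ?lexx.
apply: (@le_trans _ _ (2 / theta * r `^ (2 * theta) + 2 / tau * r `^ (2 * theta))).
  apply: lerD; apply: ler_wpM2l; rewrite ?divr_ge0 ?(ltW theta_gt0) ?(ltW tau_gt0)//.
    by have := lo_le n; have := lo_le 0%N; lra.
  by have := hi_le n; have := hi_le 0%N; lra.
(* [1 / theta + 1 / tau = 1 / (theta * tau)], since [theta + tau = 1]. *)
rewrite le_eqVlt; apply/orP; left; apply/eqP; rewrite /tau; field.
by rewrite (gt_eqF theta_gt0) (gt_eqF tau_gt0).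
Qed.

End DyadicSum.

(** * The weighted sum of the scale kernels *)

Lemma dyadic_scale (R : realType) (r : R) : 0 < r ->
  exists k : int, 2 ^ k < r <= 2 * 2 ^ k.
Proof.
move=> r0; have l2 : 0 < ln 2 :> R by rewrite ln_gt0// ltr1n.
have rE : r = 2 `^ (ln r / ln 2) by rewrite /powR pnatr_eq0/= mulfVK ?gt_eqF// lnK.
(* Rounding up and subtracting one makes the left inequality strict, as separation at scale [2^k]
   demands. *)
pose c := Num.ceil (ln r / ln 2); exists (c - 1).
have /andP[lo hi] := ceil_itv (ln r / ln 2).
have -> : 2 * 2 ^ (c - 1) = 2 ^ c :> R.
  by rewrite -{1}[2]expr1z -exprzDr ?unitfE// addrC subrK.
rewrite -!powR_intmul//; apply/andP; split; last first.
  by rewrite [leLHS]rE; apply: ler_powR => //; rewrite ler1n.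
by rewrite [ltRHS]rE /powR pnatr_eq0/= ltr_expR ltr_pM2r.
Qed.

Lemma kernel_sqdist_ge0 (R : realType) (X : Type) (K : X -> X -> R) x y :
  psd K -> 0 <= kernel_sqdist K x y.
Proof. by move=> Kpsd; rewrite -(rkhs_point_dist Kpsd) sqr_ge0. Qed.

(** The finite set [S] involves finitely many scales, while the upper bound does not depend on how
    many are summed. The weight [t^(-2(1 - theta))] turns [t^2] into [t^(2 theta)]. *)
Lemma multiscale_kernel (X : choiceType) (d : X -> X -> R) (eps delta theta : R)
    (S : seq (X * X)) :
  0 < eps < 1 -> 0 < delta < 1 -> 0 < theta < 1 -> is_metric d ->
  (forall k : int, has_padded_decomposition d (2 ^ k) eps delta) ->
  exists K, [/\ psd K,
    forall x y, kernel_sqdist K x y <=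
      4 / (theta * (1 - theta)) * (d x y `^ theta) ^+ 2 &
    forall x y, (x, y) \in S ->
      delta * eps ^+ 2 / 4 * (d x y `^ theta) ^+ 2 <= kernel_sqdist K x y].
Proof.
move=> eps01 delta01 theta01 dmet dec.
have /andP[theta0 theta1] := theta01; have /andP[delta0 _] := delta01.
have d_ge0 x y : 0 <= d x y by case: dmet.
have powE x y : (d x y `^ theta) ^+ 2 = d x y `^ (2 * theta).
  by rewrite -powR_mulrn ?powR_ge0// -powRrM mulrC.
pose tau := 1 - theta.
have /choice[k kP] (p : X * X) : exists k : int,
    0 < d p.1 p.2 -> 2 ^ k < d p.1 p.2 <= 2 * 2 ^ k.
  have [/dyadic_scale[k kP]|_] := ltP 0 (d p.1 p.2); [by exists k|by exists 0].
(* The chosen exponents of pairs in [S] lie in [[-n, n]]; indices are shifted by [n], whence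
   [2n + 1] scales. *)
pose n := \max_(p <- S) absz (k p).
pose t (i : nat) : R := 2 ^ (i%:Z - n%:Z).
have t0 i : 0 < t i by rewrite exprz_gt0.
have tS i : t i.+1 = 2 * t i.
  by rewrite /t -{2}[2]expr1z -exprzDr ?unitfE// intS addrA.
have /choice[K KP] (i : nat) := scale_kernel [seq p.1 | p <- S] dmet (ltW (t0 i))
  eps01 (dec (i%:Z - n%:Z)).
pose w i := (t i `^ (2 * tau))^-1.
have w0 i : 0 <= w i by rewrite invr_ge0 powR_ge0.
have Kpsd i : psd (K i) by case: (KP i).
exists (fun x y => \sum_(i <- index_iota 0 (2 * n).+1) w i * K i x y); split.
- exact: psd_sum.
- move=> x y; rewrite powE kernel_sqdist_sum.
  apply: (@le_trans _ _
      (2 * \sum_(0 <= i < (2 * n).+1) w i * Num.min (d x y) (t i) ^+ 2)).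
    rewrite mulr_sumr; apply: ler_sum => i _.
    by rewrite mulrCA ler_wpM2l//; case: (KP i).
  have [d0|d_le0] := ltP 0 (d x y).
    have := dyadic_sum_le theta01 d0 (2 * n).+1 t0 tS.
    rewrite -(ler_pM2l (ltr0Sn R 1)) => /le_trans; apply.
    by rewrite !mulrA -natrM.
  have -> : d x y = 0 by apply/eqP; rewrite eq_le d_le0 d_ge0.
  rewrite big1 ?mulr0 ?powR0 ?mulr0 ?mulf_neq0 ?(gt_eqF theta0)// => i _.
  by rewrite min_l ?(ltW (t0 i))// expr0n mulr0.
- move=> x y xyS; rewrite powE kernel_sqdist_sum.
  have [d0|d_le0] := ltP 0 (d x y); last first.
    have -> : d x y = 0 by apply/eqP; rewrite eq_le d_le0 d_ge0.
    rewrite powR0 ?mulf_neq0 ?(gt_eqF theta0)// mulr0.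
    by apply: sumr_ge0 => i _; rewrite mulr_ge0 ?kernel_sqdist_ge0.
  have kn : (`|k (x, y)| <= n)%N.
    exact: (@leq_bigmax_seq _ _ xpredT (fun p => absz (k p))).
  pose i := absz (k (x, y) + n%:Z).
  have iE : i%:Z - n%:Z = k (x, y) by lia.
  have i_lt : (i < (2 * n).+1)%N by lia.
  have /andP[td dt] : t i < d x y <= 2 * t i by rewrite /t iE; exact: (kP (x, y)).
  rewrite (bigD1_seq i) ?mem_index_iota ?iota_uniq//=.
  rewrite -[leLHS]addr0; apply: lerD; last first.
    by apply: sumr_ge0 => j _; rewrite mulr_ge0 ?kernel_sqdist_ge0.
  have [_ _ /(_ x y (map_f fst xyS) td)] := KP i.
  move/(ler_wpM2l (w0 i)); apply: le_trans.
  have -> : w i * (delta * (eps * t i) ^+ 2) =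
      delta * eps ^+ 2 * t i `^ (2 * theta).
    by rewrite -powR_split// -/tau -/(w i); ring.
  (* The factor 4 comes from [d x y <= 2 * t i] and [2 * theta <= 2]. *)
  have dE : d x y `^ (2 * theta) <= 4 * t i `^ (2 * theta).
    apply: (@le_trans _ _ ((2 * t i) `^ (2 * theta))).
      by apply: ge0_ler_powR; rewrite ?nnegrE ?mulr_ge0 ?(ltW theta0) ?(ltW (t0 i)).
    rewrite powRM ?(ltW (t0 i))// ler_wpM2r ?powR_ge0//.
    apply: (@le_trans _ _ (2 `^ 2)); first by apply: ler_powR; lra.
    by rewrite powR_mulrn// -natrX.
  have := mulr_ge0 (ltW delta0) (sqr_ge0 eps); move: (delta * _) => q q0.
  by rewrite -mulrA; apply: ler_wpM2l => //; lra.
Qed.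

(** * Passing from finite sets of pairs to all pairs *)

(** The kernel of the vectors translated so that [x0] goes to the origin. Distances are kept, and
    the diagonal becomes the squared distance to [x0], so distance bounds control the kernel. *)
Definition basepoint_kernel (R : realType) (X : Type) (x0 : X) (K : X -> X -> R)
  x y : R := K x y - K x x0 - K x0 y + K x0 x0.

(** Translation amounts to adding mass [- m] at [x0], which makes the total weight zero. *)
Lemma psd_basepoint_kernel (R : realType) (X : Type) (x0 : X) (K : X -> X -> R) :
  psd K -> psd (basepoint_kernel x0 K).
Proof.
move=> Kpsd; split=> [x y|u].
  rewrite /basepoint_kernel (Kpsd.1 y x) (Kpsd.1 y x0) (Kpsd.1 x0 x); ring.
pose m := \sum_(p <- u) p.1.
suff -> : gram (basepoint_kernel x0 K) u u =
    gram K (u ++ [:: (- m, x0)]) (u ++ [:: (- m, x0)]) by exact: Kpsd.2.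
have cst c : combine u (fun=> c) = m * c by rewrite /combine mulr_suml.
have inner x : combine u (basepoint_kernel x0 K x) =
    combine u (K x) - m * K x x0 - combine u (K x0) + m * K x0 x0.
  rewrite (_ : basepoint_kernel x0 K x =
    K x - (fun=> K x x0) - K x0 + (fun=> K x0 x0))//.
  by rewrite combineD !combineB !cst.
have outer : gram (basepoint_kernel x0 K) u u = gram K u u -
    m * combine u (K x0) - m * combine u (K x0) + m * (m * K x0 x0).
  rewrite /gram (_ : (fun x => _) = (fun x => combine u (K x)) - m *: K x0
    - (fun=> combine u (K x0)) + (fun=> m * K x0 x0)); last first.
    by apply/funext => x; rewrite inner (Kpsd.1 x).
  by rewrite combineD !combineB combineZ !cst.
have cross : gram K [:: (- m, x0)] u = - m * combine u (K x0) by exact: combine1.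
rewrite outer !gramDl !gramDr// (gramC u [:: _] Kpsd.1) cross /gram !combine1.
ring.
Qed.

Lemma basepoint_sqdist (R : realType) (X : Type) (x0 : X) (K : X -> X -> R) x y :
  psd K -> kernel_sqdist (basepoint_kernel x0 K) x y = kernel_sqdist K x y.
Proof.
move=> Kpsd; rewrite /kernel_sqdist /basepoint_kernel (Kpsd.1 x0 x) (Kpsd.1 x0 y).
ring.
Qed.

(** The image of an ultrafilter is an ultrafilter, here one containing the compact interval
    [[- M, M]]. *)
Lemma ultra_bounded_cvg (R : realType) (I : Type) (G : set_system I) (f : I -> R)
    (M : R) : UltraFilter G -> (forall i, `|f i| <= M) ->
  exists l : R, f i @[i --> G] --> l.
Proof.
move=> GU fM.
have fGU : UltraFilter (f @ G).
  split; first exact: fmap_proper_filter.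
  move=> H HF GH; rewrite predeqE => A; split; last exact: GH.
  move=> HA; have [//|GnA] := in_ultra_setVsetC (f @^-1` A) GU.
  have /filter_ex[? []//] : H (A `&` ~` A).
  by apply: filterI => //; exact: GH.
have := @segment_compact R (- M) M; rewrite compact_ultra => /(_ _ fGU)[].
  change (G [set i | (`[- M, M]%classic : set R) (f i)]).
  by apply: filterE => i /=; rewrite in_itv/= -ler_norml.
by move=> l [_ fl]; exists l.
Qed.

(** Finite lists of pairs, directed by inclusion, generate a filter; along an ultrafilter refining
    it the recentred kernels converge entrywise, and each single lower bound holds eventually. *)
Lemma psd_compactness (R : realType) (X : choiceType) (x0 : X)
    (lower upper : X -> X -> R) :
  (forall S : seq (X * X), exists K, [/\ psd K,
    forall x y, kernel_sqdist K x y <= upper x y &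
    forall x y, (x, y) \in S -> lower x y <= kernel_sqdist K x y]) ->
  exists K, psd K /\ forall x y, lower x y <= kernel_sqdist K x y <= upper x y.
Proof.
move=> /choice[K0 K0P].
pose K S := basepoint_kernel x0 (K0 S).
have Kpsd S : psd (K S) by apply: psd_basepoint_kernel; case: (K0P S).
have KE S : kernel_sqdist (K S) = kernel_sqdist (K0 S).
  by apply/funext => x; apply/funext => y; apply: basepoint_sqdist; case: (K0P S).
have Kupper S x y : kernel_sqdist (K S) x y <= upper x y.
  by rewrite KE; case: (K0P S).
have Kdiag S x : K S x x <= upper x x0.
  apply: le_trans (Kupper S x x0).
  by rewrite /kernel_sqdist /K /basepoint_kernel; lra.
(* The forms at the sum and at the difference of two point masses are nonnegative, so
   [2 * |K x y| <= K x x + K y y]. *)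
have Kbound S x y : `|K S x y| <= (upper x x0 + upper y x0) / 2.
  have := kernel_sqdist_ge0 x y (Kpsd S).
  have := (Kpsd S).2 [:: (1, x); (1, y)].
  rewrite /gram /combine !big_cons !big_nil/= ((Kpsd S).1 y x) /kernel_sqdist.
  have := Kdiag S x; have := Kdiag S y.
  by move=> *; rewrite ler_norml; apply/andP; split; lra.
pose F := filter_from [set: seq (X * X)] 
    (fun S => [set S' : seq (X * X) | {subset S <= S'}]).
have FF : ProperFilter F.
  apply: filter_from_proper; last by move=> S _; exists S => /= p.
  apply: filter_from_filter; first by exists [::].
  move=> S1 S2 _ _; exists (S1 ++ S2) => // S' sub; split => p pS;
    by apply: sub; rewrite mem_cat pS ?orbT.
have [G [GU FG]] := ultraFilterLemma FF.
have /choice[k kP] x : exists k : X -> R, forall y, K S x y @[S --> G] --> k y.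
  have /choice[l lP] y := ultra_bounded_cvg GU (fun S => Kbound S x y).
  by exists l.
have sqdist_cvg x y : kernel_sqdist (K S) x y @[S --> G] --> kernel_sqdist k x y.
  by apply: cvgD => //; apply: cvgB => //; apply: cvgMr.
exists k; split.
  split=> [x y|u].
    apply: (@cvg_unique _ (@Rhausdorff R) _ _ _ _ (kP x y)).
    by apply: cvg_trans (kP y x); under eq_cvg do rewrite (Kpsd _).1.
  have gram_cvg : gram (K S) u u @[S --> G] --> gram k u u.
    by apply: cvg_combine => x; exact: cvg_combine.
  by apply: cvg_ge_near gram_cvg _; apply: nearW => S; exact: (Kpsd S).2.
move=> x y; apply/andP; split; last first.
  by apply: cvg_le_near (sqdist_cvg x y) _; exact: nearW.
apply: cvg_ge_near (sqdist_cvg x y) _; apply: FG; exists [:: (x, y)] => // S sub.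
by rewrite KE; case: (K0P S) => _ _; apply; apply: sub; rewrite inE.
Qed.

(** * The embedding and its distortion *)

Theorem theorem5p4 :
  exists C : R, 0 < C /\
  forall (eps delta theta : R),
    0 < eps < 1 -> 0 < delta < 1 -> 0 < theta < 1 ->
  forall (X : Type) (d : X -> X -> R),
    is_metric d ->
    (forall k : int, has_padded_decomposition d (2 ^ k) eps delta) ->
    embeds_in_hilbert (fun a b => d a b `^ theta)
      (C / (eps * Num.sqrt (delta * theta * (1 - theta)))).
Proof.
(* With [C = 4] the distortion [D] satisfies [L * D^2 = U] exactly for the [L] and [U] below. *)
exists 4; split=> // eps delta theta eps01 delta01 theta01 X d dmet dec.
have /andP[eps0 _] := eps01; have /andP[delta0 _] := delta01.
have /andP[theta0 theta1] := theta01; have tau0 : 0 < 1 - theta by lra.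
pose L := delta * eps ^+ 2 / 4; pose U := 4 / (theta * (1 - theta)).
have [K [Kpsd KLU]] : exists K : X -> X -> R, psd K /\ forall x y,
    L * (d x y `^ theta) ^+ 2 <= kernel_sqdist K x y <= U * (d x y `^ theta) ^+ 2.
  (* An empty [X] has no base point; the zero kernel serves there. *)
  have [[x0]|noX] := pselect (inhabited X); last first.
    exists (fun _ _ => 0); split; last by move=> x; case: noX.
    split=> // u; rewrite /gram /combine big1// => p _.
    by rewrite big1 ?mulr0// => q _; rewrite mulr0.
  (* [{classic X}] equips [X] with the equality and choice used on finite lists. *)
  apply: (@psd_compactness _ {classic X} x0) => S.
  exact: (@multiscale_kernel {classic X}).
have L0 : 0 < L by rewrite divr_gt0 ?mulr_gt0 ?exprn_gt0.
have P0 : 0 < delta * theta * (1 - theta) by rewrite !mulr_gt0.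
apply: (psd_embeds Kpsd L0 _ _ _ KLU).
- by rewrite divr_ge0 ?mulr_ge0 ?sqrtr_ge0 ?ltW.
- rewrite expr_div_n exprMn sqr_sqrtr ?(ltW P0)// le_eqVlt /U /L.
  apply/orP; left; apply/eqP; field.
  by rewrite !gt_eqF.
- by move=> x y; exact: powR_ge0.
Qed.
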